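(* Consider the affine control system $$\dot{x}(t)=A_{0}x(t)+a_{0}+\sum_{i=1}^{m}u_{i}(t)[A_{i}x(t)+a_{i}],\quad u\in\mathcal{U},$$ on $\mathbb{R}^{n}$ and the induced control system on the upper hemisphere $\mathbb{S}^{n,+}$ of the Poincaré sphere, and let $h:\mathbb{R}^n\to\mathbb{S}^{n,+}$, $h(x)=\frac{(x,1)}{\|(x,1)\|}$. The strong chain control sets ${}_{\mathbb{S}}E^{\ast}$ on $\mathbb{S}^{n,+}$ are the sets of the form ${}_{\mathbb{S}}E^{\ast}=h(E^{\ast})$, where the $E^{\ast}$ are the strong chain control sets on $\mathbb{R}^{n}$.
   Context: Setting. $A_i\in\mathbb{R}^{n\times n}$, $a_i\in\mathbb{R}^n$, $i=0,\ldots,m$; $\Omega\subset\mathbb{R}^m$ is a convex and compact neighborhood of $0$; $\mathcal{U}=\{u\in L^\infty(\mathbb{R},\mathbb{R}^m)\mid u(t)\in\Omega\text{ for almost all }t\}$. Solutions of the affine system with $x(0)=x$ are denoted $\psi(t,x,u)$, $t\in\mathbb{R}$. Induced system. The affine system is embedded in the bilinear system on $\mathbb{R}^{n+1}$ $$\begin{pmatrix} \dot x \\ \dot z \end{pmatrix}=\begin{pmatrix} A_0 & a_0 \\ 0 & 0 \end{pmatrix}\begin{pmatrix} x \\ z \end{pmatrix}+\sum_{i=1}^m u_i(t)\begin{pmatrix} A_i & a_i \\ 0 & 0 \end{pmatrix}\begin{pmatrix} x \\ z \end{pmatrix},$$ with trajectories $\psi^1(t,x,z,u)$. Its radial projection to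 the unit sphere $\mathbb{S}^n\subset\mathbb{R}^{n+1}$ has trajectories $\mathbb{S}\psi^1(t,s,u)=\psi^1(t,s,u)/\|\psi^1(t,s,u)\|$, $s\in\mathbb{S}^n$. The set $\mathbb{S}^{n,+}=\{s\in\mathbb{S}^n\mid s_{n+1}>0\}$ is invariant, and the induced system on it is the restriction to $\mathbb{S}^{n,+}$. $\|\cdot\|$ is the Euclidean norm; on $\mathbb{S}^{n,+}$ use the metric $d(s,s')=\max_i|s_i-s'_i|$ and on $\mathbb{R}^n$ the maximum norm. Strong chain control sets (for a control system on a manifold $M$ with metric $d_M$ and trajectories $\varphi(t,x,u)$). Let $\mathcal{P}(M)$ be the set of continuous functions $\varepsilon:M\to(0,\infty)$. For $\varepsilon\in\mathcal{P}(M)$, $T>0$, a controlled $(\varepsilon,T)$-chain from $x$ to $y$ consists of $k\ge1$, $T_0,\ldots,T_{k-1}\ge T$, $u_0,\ldots,u_{k-1}\in\mathcal{U}$, $x_0=x,\ldots,x_k=y\in M$ with $d_M(\varphi(T_j,x_j,u_j),x_{j+1})<\varepsilon(\varphi(T_j,x_j,u_j))$ for all $j$. A point $x$ is strongly chain controllable to $y$ if for every $\varepsilon\in\mathcal{P}(M)$ and $T>0$ there is a controlled $(\varepsilon,T)$-chain from $x$ to $y$. A nonvoid set $E^\ast\subset M$ is a strong chain control set if (1) every $x\in E^\ast$ is strongly chain controllable to every $y\in E^\ast$, (2) for every $x\in E^\ast$ there is $u\in\mathcal{U}$ with $\varphi(t,x,u)\in E^\ast$ for all $t\in\mathbb{R}$,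 and (3) $E^\ast$ is maximal with properties (1) and (2). *)

(* Defs.v *)
(* MathComp-Analysis; vectors of R^p are columns 'cV[R]_p, whose library norm
   `|x| is the maximum norm. *)
From HB Require Import structures.
From mathcomp Require Import all_boot all_order all_algebra.
From mathcomp Require Import all_classical all_reals all_analysis.
Set Implicit Arguments.
Unset Strict Implicit.
Unset Printing Implicit Defensive.
Import Order.TTheory GRing.Theory Num.Theory.
Import numFieldNormedType.Exports.
Local Open Scope classical_set_scope.
Local Open Scope ring_scope.

(* Elements of L^oo are represented by functions; changing a control on a null
   set does not change the trajectories below. *)
Definition admissible (R : realType) (m : nat) (Omega : set 'cV[R]_m) :
    set (R -> 'cV[R]_m) :=
  [set u : R -> 'cV[R]_m |
     (forall i, (fun t : R => u t i 0) \in Lfun (@lebesgue_measure R) +oo%E)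
     /\ {ae @lebesgue_measure R, forall t, Omega (u t)}].

(* The integral of f from 0 to t, t of either sign. *)
Definition integral_from0 (R : realType) (f : R -> R) (t : R) : R :=
  if 0 <= t then \int[@lebesgue_measure R]_(s in `[0, t]) f s
  else - \int[@lebesgue_measure R]_(s in `[t, 0]) f s.

(* Caratheodory solutions of y' = F(u(t), y), y(0) = y0.  For continuous y,
   admissible u and the fields F below, the integrand is measurable and essentially
   bounded on compact intervals. *)
Definition is_solution (R : realType) (m p : nat)
    (F : 'cV[R]_m -> 'cV[R]_p -> 'cV[R]_p) (u : R -> 'cV[R]_m) (y0 : 'cV[R]_p)
    : set (R -> 'cV[R]_p) :=
  [set y : R -> 'cV[R]_p | continuous y /\
     forall (t : R) (i : 'I_p), 
       y t i 0 = y0 i 0 + integral_from0 (fun s => F (u s) (y s) i 0) t].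

(* The solution is selected by choice.  For admissible u and the fields F below
   it exists and is unique, so the default value is never used. *)
Definition solution (R : realType) (m p : nat)
    (F : 'cV[R]_m -> 'cV[R]_p -> 'cV[R]_p) (t : R) (y0 : 'cV[R]_p)
    (u : R -> 'cV[R]_m) : 'cV[R]_p :=
  xget (fun=> y0) (is_solution F u y0) t.

Definition affine_field (R : realType) (n m : nat) (A0 : 'M[R]_n) (a0 : 'cV[R]_n)
    (A : 'I_m -> 'M[R]_n) (a : 'I_m -> 'cV[R]_n) (v : 'cV[R]_m) (x : 'cV[R]_n) :
    'cV[R]_n :=
  A0 *m x + a0 + \sum_i v i 0 *: (A i *m x + a i).

Definition affine_flow (R : realType) (n m : nat) (A0 : 'M[R]_n) (a0 : 'cV[R]_n)
    (A : 'I_m -> 'M[R]_n) (a : 'I_m -> 'cV[R]_n) :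
    R -> 'cV[R]_n -> (R -> 'cV[R]_m) -> 'cV[R]_n :=
  solution (affine_field A0 a0 A a).

Definition embed_mx (R : realType) (n : nat) (A : 'M[R]_n) (a : 'cV[R]_n) :
    'M[R]_(n + 1) :=
  block_mx A a 0 0.

Definition bilinear_field (R : realType) (n m : nat) (A0 : 'M[R]_n)
    (a0 : 'cV[R]_n) (A : 'I_m -> 'M[R]_n) (a : 'I_m -> 'cV[R]_n)
    (v : 'cV[R]_m) (y : 'cV[R]_(n + 1)) : 'cV[R]_(n + 1) :=
  embed_mx A0 a0 *m y + \sum_i v i 0 *: (embed_mx (A i) (a i) *m y).

Definition enorm (R : realType) (p : nat) (y : 'cV[R]_p) : R :=
  Num.sqrt (\sum_i y i 0 ^+ 2).

Definition radial (R : realType) (p : nat) (y : 'cV[R]_p) : 'cV[R]_p :=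
  (enorm y)^-1 *: y.

Definition sphere_flow (R : realType) (n m : nat) (A0 : 'M[R]_n) (a0 : 'cV[R]_n)
    (A : 'I_m -> 'M[R]_n) (a : 'I_m -> 'cV[R]_n) (t : R) (s : 'cV[R]_(n + 1))
    (u : R -> 'cV[R]_m) : 'cV[R]_(n + 1) :=
  radial (solution (bilinear_field A0 a0 A a) t s u).

Definition upper_hemisphere (R : realType) (n : nat) : set 'cV[R]_(n + 1) :=
  [set s | enorm s = 1 /\ 0 < s (rshift n ord0) 0].

Definition hemisphere_map (R : realType) (n : nat) (x : 'cV[R]_n) :
    'cV[R]_(n + 1) :=
  radial (col_mx x 1).

(* In the next definitions the state space M is a subset of a normed space V,
   with the metric `|x - y|, and phi t x u is the trajectory map, of which only
   the values at x in M and u in U matter. *)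

(* The functions in P(M); values outside M are irrelevant. *)
Definition chain_tolerance (R : realType) (V : normedModType R) (M : set V) :
    set (V -> R) :=
  [set eps : V -> R | {within M, continuous eps} /\ forall x, M x -> 0 < eps x].

Definition controlled_chain (R : realType) (V : normedModType R) (C : Type)
    (M : set V) (U : set C) (phi : R -> V -> C -> V) (eps : V -> R) (T : R)
    (x y : V) : Prop :=
  exists (k : nat) (Ts : nat -> R) (us : nat -> C) (xs : nat -> V),
    [/\ (1 <= k)%N,
        xs 0%N = x,
        xs k = y,
        (forall j, (j <= k)%N -> M (xs j)) &
        forall j, (j < k)%N ->
          [/\ T <= Ts j, U (us j) &
              `|phi (Ts j) (xs j) (us j) - xs j.+1|
                < eps (phi (Ts j) (xs j) (us j))]].

Definition strongly_chain_controllable (R : realType) (V : normedModType R)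
    (C : Type) (M : set V) (U : set C) (phi : R -> V -> C -> V) (x y : V) : Prop :=
  forall (eps : V -> R) (T : R), chain_tolerance M eps -> 0 < T ->
    controlled_chain M U phi eps T x y.

Definition chain_viable (R : realType) (V : normedModType R) (C : Type)
    (M : set V) (U : set C) (phi : R -> V -> C -> V) (E : set V) : Prop :=
  (forall x y, E x -> E y -> strongly_chain_controllable M U phi x y) /\
  (forall x, E x -> exists2 u, U u & forall t, E (phi t x u)).

Definition strong_chain_control_set (R : realType) (V : normedModType R)
    (C : Type) (M : set V) (U : set C) (phi : R -> V -> C -> V) (E : set V) : Prop :=
  [/\ E !=set0,
      E `<=` M,
      chain_viable M U phi E &
      forall E', E' `<=` M -> chain_viable M U phi E' -> E `<=` E' -> E' = E].

(* Main.v *)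
(* The map h is a homeomorphism of R^n onto the open upper hemisphere, with
   inverse s |-> (s_1, ..., s_n) / s_(n+1), and it conjugates the two flows: the
   last coordinate of a bilinear trajectory is constant, so the trajectories of
   the bilinear system from c (x, 1) are the curves c (y, 1), y a trajectory of
   the affine system from x.  Uniqueness of affine trajectories then identifies
   the chosen solutions.  Since tolerances are arbitrary positive continuous
   functions, strong chain controllability does not depend on the metric: a
   tolerance eps on one side pulls back to a tolerance delta on the other side
   such that delta-chains are mapped to eps-chains. *)
Require Import Defs.
From HB Require Import structures.
From mathcomp Require Import all_boot all_order all_algebra.
From mathcomp Require Import all_classical all_reals all_analysis.
From mathcomp Require Import measurable_realfun ess_sup_inf ring lra.
Set Implicit Arguments.
Unset Strict Implicit.
Unset Printing Implicit Defensive.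
Import Order.TTheory GRing.Theory Num.Theory.
Import numFieldNormedType.Exports.
Local Open Scope classical_set_scope.
Local Open Scope ring_scope.

(* [delta x] is the supremum of the radii [r <= 1] such that [h] satisfies the
   [eps]-estimate on the whole [r]-ball around [x]; quantifying over pairs of
   points in the ball makes it 1-Lipschitz, hence continuous. *)
Lemma pull_back_tolerance (R : realType) (V W : normedModType R) (M : set V)
    (N : set W) (h : V -> W) (eps : W -> R) :
  {within M, continuous h} -> (forall x, M x -> N (h x)) ->
  chain_tolerance N eps ->
  exists2 delta : V -> R, chain_tolerance M delta &
    forall x y, M x -> M y -> `|x - y| < delta x -> `|h x - h y| < eps (h x).
Proof.
move=> /subspace_continuousP hc hMN [/subspace_continuousP epsc eps0].
pose D x := [set r : R | 0 <= r <= 1 /\ forall y z, M y -> M z ->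
   `|x - y| < r -> `|x - z| < r -> `|h y - h z| < eps (h y)].
pose delta x := sup (D x).
have D0 x : D x 0.
  by split=> [|y z _ _]; [rewrite lexx ler01 | rewrite ltNge normr_ge0].
have Dsup x : has_sup (D x).
  by split; [exists 0 | exists 1 => r [/andP[]]].
have Dle x r : D x r -> r <= delta x.
  by move=> Dr; apply: sup_upper_bound.
have dlip x x' : delta x <= delta x' + `|x - x'|.
  apply: ge_sup; first by exists 0.
  move=> r [/andP[r0 r1] Dr].
  (* A radius [r] admissible at [x] leaves the radius [r - |x - x'|] at [x'], by the triangle
     inequality; if that is not positive, [0 <= delta x'] suffices. *)
  have [rle|rgt] := leP r `|x - x'|.
    by rewrite (le_trans rle)// lerDr Dle.
  rewrite -lerBlDr; apply: Dle; split.
    by rewrite subr_ge0 (ltW rgt) /= (le_trans _ r1)// gerBl.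
  have step z : `|x' - z| < r - `|x - x'| -> `|x - z| < r.
    by move=> zr; rewrite (le_lt_trans (ler_distD x' _ _))// -ltrBrDl.
  by move=> y z My Mz /step yr /step zr; exact: Dr.
have dcont : continuous delta.
  move=> x; apply/cvgrPdist_lt => e e0; near=> y.
  suff : `|delta x - delta y| <= `|x - y|.
    by move/le_lt_trans; apply; near: y; apply: cvgr_dist_lt.
  by rewrite ler_norml; have := dlip x y; have := dlip y x; rewrite (distrC y x); lra.
exists delta; first split.
- exact: continuous_subspaceT.
- move=> x Mx.
  (* With quarters, [h y] and [h z] are less than half of [eps (h x)] apart, while [eps (h y)]
     exceeds three quarters of it. *)
  have e0 : 0 < eps (h x) / 4 by apply: divr_gt0 => //; exact/eps0/hMN.
  have hx : h y @[y --> within M (nbhs x)] --> h x := hc x Mx.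
  have ex : eps y @[y --> within N (nbhs (h x))] --> eps (h x) :=
    epsc (h x) (hMN x Mx).
  have : \forall y \near x, M y ->
      `|h x - h y| < eps (h x) / 4 /\ `|eps (h x) - eps (h y)| < eps (h x) / 4.
    have hN : h @ within M (nbhs x) --> within N (nbhs (h x)).
      move=> B NB.
      have : nbhs x [set y | M y -> N (h y) -> B (h y)] := hx _ NB.
      by apply: filterS => y HB My; apply: HB => //; exact: hMN.
    have H1 : nbhs x [set y | M y -> `|h x - h y| < eps (h x) / 4].
      by move/cvgrPdist_lt : hx; exact.
    have H2 : nbhs x [set y | M y ->
        `|eps (h x) - eps (h y)| < eps (h x) / 4].
      by have /cvgrPdist_lt := cvg_comp _ _ hN ex; exact.
    by apply: filterS2 H1 H2 => y H1 H2 My; split; [exact: H1 | exact: H2].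
  move=> /nbhs_normP[r /= r0 Hr].
  have r'0 : 0 < Num.min r 1 by rewrite lt_min r0 ltr01.
  apply: (lt_le_trans r'0); apply: Dle; split.
    by rewrite (ltW r'0) ge_min lexx orbT.
  move=> y z My Mz; rewrite !lt_min => /andP[yr _] /andP[zr _].
  have [hy ey] := Hr y yr My; have [hz _] := Hr z zr Mz.
  have := ler_distD (h x) (h y) (h z).
  move: ey hy hz; rewrite (distrC (h x) (h y)) ltr_norml => /andP[].
  by lra.
- move=> x y Mx My xy.
  have xy0 : 0 < delta x - `|x - y| by rewrite subr_gt0.
  (* The supremum need not be attained, but some admissible radius [r] exceeds [|x - y|]; the pair
     to test is then the centre [x] and [y]. *)
  have [r Dr xyr] := sup_adherent xy0 (Dsup x).
  case: Dr => /andP[r0 _]; apply => //.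
    rewrite subrr normr0; apply: le_lt_trans xyr.
    by rewrite -/(delta x) opprB addrCA subrr addr0.
  by apply: le_lt_trans xyr; rewrite -/(delta x) opprB addrCA subrr addr0.
Unshelve. all: by end_near. Qed.

(** * Transport of strong chain control sets along a conjugacy *)

Section conjugacy.
Context {R : realType} {C : Type} (U : set C).

(** Flows are compared only at states in [M] and controls in [U]. Invariance of [N] follows from
    that of [M], so the notion is symmetric and each transport lemma also serves for [g]. *)
Record chain_conjugacy (V W : normedModType R) (M : set V) (N : set W)
    (phi : R -> V -> C -> V) (psi : R -> W -> C -> W)
    (h : V -> W) (g : W -> V) : Prop := ChainConjugacy {
  conj_continuous : {within M, continuous h};
  conj_inv_continuous : {within N, continuous g};
  conj_fun : forall x, M x -> N (h x);
  conj_inv_fun : forall y, N y -> M (g y);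
  conjK : forall x, M x -> g (h x) = x;
  conj_invK : forall y, N y -> h (g y) = y;
  conj_flow_in : forall t x u, M x -> U u -> M (phi t x u);
  conj_flow : forall t x u, M x -> U u -> psi t (h x) u = h (phi t x u) }.

Lemma chain_conjugacy_sym (V W : normedModType R) (M : set V) (N : set W)
    phi psi (h : V -> W) (g : W -> V) :
  chain_conjugacy M N phi psi h g -> chain_conjugacy N M psi phi g h.
Proof.
move=> [hc gc hMN gNM hK gK phiM phih]; split=> // t y u Ny Uu.
  by rewrite -(gK y Ny) phih//; [exact/hMN/phiM/Uu/gNM | exact: gNM].
by rewrite -{2}(gK y Ny) phih//; [rewrite hK//; apply: phiM => // |]; exact: gNM.
Qed.

(** Times and controls of a chain are kept and its points are mapped by [h]. The tolerance is
    evaluated at the endpoint of each piece, which is the first argument in the estimate of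
    [pull_back_tolerance]. *)
Lemma controllable_conjugacy (V W : normedModType R) (M : set V) (N : set W)
    phi psi (h : V -> W) (g : W -> V) x y :
  chain_conjugacy M N phi psi h g ->
  strongly_chain_controllable M U phi x y ->
  strongly_chain_controllable N U psi (h x) (h y).
Proof.
move=> [hc gc hMN gNM hK gK phiM phih] xy eps T eps_tol T0.
have [delta delta_tol deltaP] := pull_back_tolerance hc hMN eps_tol.
have [k [Ts [us [xs [k1 <- <- xsM chain]]]]] := xy delta T delta_tol T0.
exists k, Ts, us, (h \o xs); split=> // j jk; first exact/hMN/xsM.
have [TT Uu lt_delta] := chain j jk; have Mj := xsM j (ltnW jk).
split=> //=; rewrite phih//; apply: deltaP => //; [exact: phiM | exact: xsM].
Qed.

Lemma chain_viable_conjugacy (V W : normedModType R) (M : set V) (N : set W)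
    phi psi (h : V -> W) (g : W -> V) (E : set V) :
  chain_conjugacy M N phi psi h g -> E `<=` M ->
  chain_viable M U phi E -> chain_viable N U psi (h @` E).
Proof.
move=> cj EM [ctrl via]; split.
  move=> _ _ [x Ex <-] [y Ey <-].
  by apply: controllable_conjugacy cj _; exact: ctrl.
move=> _ [x Ex <-]; have [u Uu uE] := via x Ex; exists u => // t.
by rewrite (conj_flow cj)//; [exists (phi t x u) | exact: EM].
Qed.

Lemma conj_image_sub (V W : normedModType R) (M : set V) (N : set W)
    phi psi (h : V -> W) (g : W -> V) (E : set V) :
  chain_conjugacy M N phi psi h g -> E `<=` M -> h @` E `<=` N.
Proof. by move=> cj EM _ [x /EM Mx <-]; exact: (conj_fun cj). Qed.

Lemma conj_imageK (V W : normedModType R) (M : set V) (N : set W)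
    phi psi (h : V -> W) (g : W -> V) (E : set V) :
  chain_conjugacy M N phi psi h g -> E `<=` M -> g @` (h @` E) = E.
Proof.
move=> cj EM; apply/seteqP; split=> [_ [_ [x Ex <-] <-]|x Ex].
  by rewrite (conjK cj)//; exact: EM.
by exists (h x); [exists x | rewrite (conjK cj)//; exact: EM].
Qed.

Lemma strong_chain_control_set_conjugacy (V W : normedModType R) (M : set V)
    (N : set W) phi psi (h : V -> W) (g : W -> V) (E : set V) :
  chain_conjugacy M N phi psi h g ->
  strong_chain_control_set M U phi E ->
  strong_chain_control_set N U psi (h @` E).
Proof.
move=> cj [[x Ex] EM viaE maxE]; have cj' := chain_conjugacy_sym cj.
split.
- by exists (h x), x.
- exact: conj_image_sub cj EM.
- exact: chain_viable_conjugacy cj EM viaE.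
(* A viable [F] containing the image of [E] pulls back to a viable set containing [E]; maximality of
   [E] makes them equal, and applying [h] recovers [F]. *)
- move=> F FN viaF EF.
  rewrite -(conj_imageK cj' FN); congr (h @` _); apply: maxE.
  + exact: conj_image_sub cj' FN.
  + exact: chain_viable_conjugacy cj' FN viaF.
  + by rewrite -(conj_imageK cj EM); exact: image_subset.
Qed.

End conjugacy.

(** * Integrals over compact intervals *)

Section integral_from0.
Context {R : realType}.
Notation mu := (@lebesgue_measure R).

Lemma lebesgue_measure_segment (a b : R) : a <= b ->
  mu `[a, b] = (b - a)%:E.
Proof.
move=> ab; rewrite lebesgue_measure_itv /= lte_fin EFinB.
by case: ltgtP ab => // -> _; rewrite -EFinB subrr.
Qed.

(** Kept in the extended reals so that it can also serve to establish integrability of [f]. *)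
Lemma integral_abse_segment_le (f : R -> R) (a b C : R) :
  measurable_fun `[a, b] f -> 0 <= C ->
  {ae mu, forall s, `[a, b]%classic s -> `|f s| <= C} ->
  (\int[mu]_(s in `[a, b]) `|(f s)%:E| <= C%:E * mu `[a, b])%E.
Proof.
move=> mf C0 fC; rewrite -integral_cst//.
apply: ae_ge0_le_integral => //.
by apply/measurable_EFinP; exact: measurableT_comp.
Qed.

Lemma normr_Rintegral_segment_le (f : R -> R) (a b C : R) : a <= b -> 0 <= C ->
  mu.-integrable `[a, b] (EFin \o f) ->
  {ae mu, forall s, `[a, b]%classic s -> `|f s| <= C} ->
  `|\int[mu]_(s in `[a, b]) f s| <= C * (b - a).
Proof.
move=> ab C0 fint fC.
apply: (le_trans (le_normr_Rintegral _ fint)) => //.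
have mf : measurable_fun `[a, b] f.
  by apply/measurable_EFinP; exact: (measurable_int mu fint).
have := integral_abse_segment_le mf C0 fC.
rewrite (lebesgue_measure_segment ab) -EFinM => le_int.
rewrite -[leRHS]/(fine (C * (b - a))%:E) /Rintegral fine_le//.
apply: integrable_fin_num => //=.
exact: (integrable_norm fint).
Qed.

Lemma Rintegral_segmentD (f : R -> R) (a c b : R) : a <= c -> c <= b ->
  mu.-integrable `[a, b] (EFin \o f) ->
  \int[mu]_(s in `[a, c]) f s + \int[mu]_(s in `[c, b]) f s =
  \int[mu]_(s in `[a, b]) f s.
Proof.
move=> ac cb fint.
have := Rintegral_itvB (x := c) fint; rewrite !bnd_simp => /(_ ac cb) fB.
rewrite -(Rintegral_itv_obnd_cbnd (f := f) (r := c)); first by rewrite -fB subrKC.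
by apply: integrableS fint => //; apply: subset_itvr; rewrite bnd_simp.
Qed.

(** The sign convention for negative arguments makes this hold wherever 0 lies relative to the
    interval; the three positions are treated in turn. *)
Lemma integral_from0B (f : R -> R) (a b : R) : a <= b ->
  (forall c d, mu.-integrable `[c, d] (EFin \o f)) ->
  integral_from0 f b - integral_from0 f a = \int[mu]_(s in `[a, b]) f s.
Proof.
move=> ab fint; rewrite /integral_from0.
have [a0|a0] := leP 0 a.
  by rewrite (le_trans a0 ab) -(Rintegral_segmentD a0 ab (fint _ _)) addrAC subrr add0r.
rewrite opprK; have [b0|b0] := leP 0 b.
  by rewrite addrC Rintegral_segmentD// ltW.
by rewrite -(Rintegral_segmentD ab (ltW b0) (fint _ _)) addrCA addNr addr0.
Qed.

Lemma integral_from0Z (f : R -> R) (c t : R) :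
  (forall a b, mu.-integrable `[a, b] (EFin \o f)) ->
  integral_from0 (fun s => c * f s) t = c * integral_from0 f t.
Proof.
by move=> fint; rewrite /integral_from0 !RintegralZl//; case: ifP; rewrite ?mulrN.
Qed.

Lemma integral_from0_0 (f : R -> R) : integral_from0 f 0 = 0.
Proof. by rewrite /integral_from0 lexx set_itv1 Rintegral_set1. Qed.

Lemma integral_from0_eq0 (f : R -> R) (t : R) :
  (forall s, f s = 0) -> integral_from0 f t = 0.
Proof.
move=> /funext ->; rewrite /integral_from0 !Rintegral_cst//.
by rewrite !mul0r oppr0 if_same.
Qed.

End integral_from0.

(** * The maximum norm of a column *)

Section vector_norm.
Context {R : realType} {p : nat}.
Implicit Types v : 'cV[R]_p.

Lemma cV_norm_le v (C : R) : 0 <= C -> (forall i, `|v i 0| <= C) -> `|v| <= C.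
Proof.
move=> C0 vC; rewrite [leLHS]mx_normrE; apply/bigmax_leP; split=> // -[i j] _ /=.
by rewrite (ord1 j).
Qed.

Lemma cV_coord_le v i : `|v i 0| <= `|v|.
Proof.
rewrite [leRHS]mx_normrE.
by apply: (le_bigmax _ (fun ij : 'I_p * 'I_1 => `|v ij.1 ij.2|) (i, 0)).
Qed.

End vector_norm.

(** * A Gronwall-type uniqueness argument *)

Section zero_solution.
Context {R : realType} {p : nat}.
Notation mu := (@lebesgue_measure R).
(** In the application [w] is the difference of two trajectories, [g] the difference of the fields
    along them, and [K] a Lipschitz constant valid for almost all times. *)
Variables (w g : R -> 'cV[R]_p) (K : R).
Hypotheses (w_cont : continuous w) (K_gt0 : 0 < K)
  (g_int : forall i a b, mu.-integrable `[a, b] (fun s => (g s i 0)%:E))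
  (g_le : {ae mu, forall s, `|g s| <= K * `|w s|})
  (w_int : forall i a b, a <= b ->
    w b i 0 - w a i 0 = \int[mu]_(s in `[a, b]) g s i 0).

Let d := (2 * K)^-1.

(* If |w| has maximum S on the d-neighborhood of a zero of w, then
   |w| <= K S d = S / 2 there. *)
Lemma zero_solution_near s t : w s = 0 -> `|t - s| <= d -> w t = 0.
Proof.
move=> ws0 tsd; have d0 : 0 < d by rewrite invr_gt0 mulr_gt0.
have Kd : K * d = 1 / 2 by rewrite /d; field; rewrite lt0r_neq0.
have [||c cI cmax] := @EVT_max R (fun r => `|w r|) (s - d) (s + d).
- lra.
- apply: continuous_subspaceT => r.
  by apply: (@cvg_norm _ _ _ _ _ w); exact: w_cont.
have bound : forall r, r \in `[s - d, s + d] -> `|w r| <= `|w c| / 2.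
  have est i a b : s - d <= a -> a <= b -> b <= s + d -> b - a <= d ->
      `|w b i 0 - w a i 0| <= `|w c| / 2.
    move=> sa ab bs bad; rewrite w_int//.
    apply: (le_trans (normr_Rintegral_segment_le (C := K * `|w c|) ab _ _ _)).
    + by rewrite mulr_ge0// ltW.
    + exact: g_int.
    + apply: (filterS (Filter := ae_filter_ringOfSetsType mu)) g_le => r gr.
      rewrite /= in_itv /= => /andP[ar rb].
      apply: le_trans (cV_coord_le _ _) (le_trans gr _).
      rewrite ler_pM2l// cmax// in_itv/=; apply/andP; split; lra.
    + apply: (@le_trans _ _ (K * `|w c| * d)).
        by apply: ler_wpM2l => //; rewrite mulr_ge0// ltW.
      by rewrite mulrAC Kd; lra.
  move=> r; rewrite in_itv/= => /andP[r1 r2].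
  apply: cV_norm_le => [|i]; first by rewrite divr_ge0.
  have [sr|rs] := leP s r.
    have := est i s r; rewrite ws0 mxE subr0; apply; lra.
  have := est i r s; rewrite ws0 mxE sub0r normrN; apply; lra.
(* At the maximizer itself the bound reads [|w c| <= |w c| / 2]. *)
have wc0 : `|w c| = 0.
  by have := bound c cI; have := normr_ge0 (w c); lra.
have := bound t; rewrite wc0 mul0r in_itv/= => H.
apply/eqP; rewrite -normr_le0; apply: H.
move: tsd; rewrite ler_norml => /andP[]; lra.
Qed.

Lemma zero_solution : w 0 = 0 -> forall t, w t = 0.
Proof.
move=> w0; have d0 : 0 < d by rewrite invr_gt0 mulr_gt0.
have H k : forall t, `|t| <= k%:R * d -> w t = 0.
  elim: k => [|k IH] t; first by rewrite mul0r normr_le0 => /eqP ->.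
  (* Scaling by [r = k / (k + 1)] handles both signs of [t]: the point [r * t] has modulus at most
     [k * d], and its distance to [t] is [|t| / (k + 1) <= d]. *)
  move=> tk; pose r := k%:R / k.+1%:R : R.
  have k0 : (0 : R) < k.+1%:R by [].
  have r0 : 0 <= r by rewrite divr_ge0.
  have r1 : 1 - r = k.+1%:R^-1.
    by rewrite /r -natr1; field; rewrite natr1 lt0r_neq0.
  apply: (@zero_solution_near (r * t)).
    apply: IH; rewrite normrM ger0_norm//.
    apply: le_trans (ler_wpM2l r0 tk) _.
    by rewrite mulrA /r divfK// lt0r_neq0.
  rewrite -{1}(mul1r t) -mulrBl r1 normrM ger0_norm ?invr_ge0//.
  by rewrite mulrC ler_pdivrMr// mulrC.
move=> t; apply: (H (Num.truncn (`|t| / d)).+1).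
by rewrite -ler_pdivrMr// ltW// truncnS_gt.
Qed.

End zero_solution.

(** * Entrywise limits of matrices *)

Section matrix_continuity.
Context {R : realType}.

(** A neighborhood of a matrix contains a product of neighborhoods of its entries, and finitely many
    eventual conditions hold eventually together. *)
Lemma cvg_mx {T : Type} {F : set_system T} {FF : Filter F} (m n : nat)
    (f : T -> 'M[R]_(m, n)) (l : 'M[R]_(m, n)) :
  (forall i j, f x i j @[x --> F] --> l i j) -> f x @[x --> F] --> l.
Proof.
move=> fl B [P lP PB].
have : \forall x \near F, forall ij : 'I_m * 'I_n, P ij.1 ij.2 (f x ij.1 ij.2).
  by apply: filter_forall => -[i j]; exact: (fl i j _ (lP i j)).
by apply: filterS => x fP; apply: PB => i j; exact: (fP (i, j)).
Qed.

Lemma cvg_coord {T : Type} {F : set_system T} {FF : Filter F} (m n : nat)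
    (f : T -> 'M[R]_(m, n)) (l : 'M[R]_(m, n)) i j :
  f x @[x --> F] --> l -> f x i j @[x --> F] --> l i j.
Proof. by move=> fl; exact: (cvg_comp _ _ fl (@coord_continuous R m n i j l)). Qed.

Lemma cvg_mulmx {T : Type} {F : set_system T} {FF : Filter F} (m n p : nat)
    (A : 'M[R]_(m, n)) (f : T -> 'M[R]_(n, p)) (l : 'M[R]_(n, p)) :
  f x @[x --> F] --> l -> A *m f x @[x --> F] --> A *m l.
Proof.
move=> fl; apply: cvg_mx => i j; rewrite mxE.
under eq_fun do rewrite mxE.
apply: cvg_big => [|k _]; first exact: add_continuous.
by apply: cvgM; [exact: cvg_cst | exact: cvg_coord].
Qed.

End matrix_continuity.

(** The matrix norm is the largest entry, not an operator norm; the factor [q%:R] counts the terms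
    of each entry of the product. *)
Lemma mulmx_norm_le (R : realType) (p q : nat) (B : 'M[R]_(p, q)) (x : 'cV[R]_q) :
  `|B *m x| <= q%:R * `|B| * `|x|.
Proof.
apply: cV_norm_le => [|i]; first by rewrite !mulr_ge0.
rewrite mxE (le_trans (ler_norm_sum _ _ _))//.
rewrite -[X in X%:R](card_ord q) -mulrA mulr_natl -sumr_const.
apply: ler_sum => j _; rewrite normrM ler_pM// ?cV_coord_le//.
rewrite [leRHS]mx_normrE.
by apply: (le_bigmax _ (fun ij : 'I_p * 'I_q => `|B ij.1 ij.2|) (i, j)).
Qed.

Lemma is_solution_at0 (R : realType) (m p : nat)
    (F : 'cV[R]_m -> 'cV[R]_p -> 'cV[R]_p) (v : R -> 'cV[R]_m) (y0 : 'cV[R]_p) y :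
  is_solution F v y0 y -> y 0 = y0.
Proof.
move=> [_ ysol]; apply/colP => i.
by rewrite ysol integral_from0_0 addr0.
Qed.

(** * Integrability along admissible controls and uniqueness of affine trajectories *)

Section affine_solutions.
Context {R : realType} {n m : nat}.
Notation mu := (@lebesgue_measure R).
Variables (A0 : 'M[R]_n) (a0 : 'cV[R]_n) (A : 'I_m -> 'M[R]_n)
  (a : 'I_m -> 'cV[R]_n) (Omega : set 'cV[R]_m) (u : R -> 'cV[R]_m).
Hypothesis u_adm : admissible Omega u.

Lemma admissible_measurable k : measurable_fun setT (fun t => u t k 0).
Proof. by have [/(_ k) + _] := u_adm; rewrite inE => /andP[]; rewrite inE. Qed.

Lemma admissible_ae_bounded : exists2 C : R, 0 <= C &
  {ae mu, forall t, forall k, `|u t k 0| <= C}.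
Proof.
have bnd k : exists C : R, {ae mu, forall t, `|u t k 0| <= C}.
  have [/(_ k) + _] := u_adm; rewrite inE => /andP[_].
  rewrite !inE/= /finite_norm unlock /Lnorm.
  case: ifPn => [_ /ess_supr_bounded //|/negP[]].
  (* The norm with exponent [+oo] is an essential supremum only on a space of positive measure, so
     the other branch is refuted by computing the measure of the line. *)
  have muT := lebesgue_measure_itv (`]-oo, +oo[ : interval R).
  rewrite set_itvNyy /= in muT.
  have muT_gt0 : (0 < mu [set: R])%E by rewrite muT addye ?ltry.
  exact: muT_gt0.
have [C HC] := choice bnd.
exists (\sum_k `|C k|); first exact: sumr_ge0.
apply: (filterS (Filter := ae_filter_ringOfSetsType mu))
  (filter_forall (ae_filter_ringOfSetsType mu) HC) => t uC k.
apply: le_trans (uC k) (le_trans (ler_norm _) _).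
by rewrite (bigD1 k)//= lerDl sumr_ge0.
Qed.

Lemma integrable_admissibleM (c : R -> R) k b d : continuous c ->
  mu.-integrable `[b, d] (fun s => (u s k 0 * c s)%:E).
Proof.
move=> cc; have [C C0 uC] := admissible_ae_bounded.
have /compact_bounded[M [_ cM]] : compact (c @` `[b, d]%classic).
  apply: continuous_compact; first exact: continuous_subspaceT.
  exact: segment_compact.
(* Every number strictly above [M] is a bound; [|M| + 1] is one that is also nonnegative. *)
have {}cM s : `[b, d]%classic s -> `|c s| <= `|M| + 1.
  move=> sI; apply: cM; last by exists s.
  by rewrite (le_lt_trans (ler_norm M))// ltrDl.
have mf : measurable_fun `[b, d] (fun s => u s k 0 * c s).
  apply: measurable_funTS; apply: measurable_funM.
    exact: admissible_measurable.
  exact: continuous_measurable_fun.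
apply/integrableP; split; first exact/measurable_EFinP.
apply: le_lt_trans (integral_abse_segment_le (C := C * (`|M| + 1)) mf _ _) _.
- by rewrite mulr_ge0// addr_ge0.
- apply: (filterS (Filter := ae_filter_ringOfSetsType mu)) uC => s uC sI.
  by rewrite normrM ler_pM//; exact: cM.
- have [bd|db] := leP b d; first by rewrite lebesgue_measure_segment// -EFinM ltry.
  by rewrite set_itv_ge ?bnd_simp -?ltNge// measure0 mule0.
Qed.

(** Along a continuous curve the field is a continuous term plus finitely many products of a control
    coordinate with a continuous coefficient. *)
Lemma integrable_affine_field (y : R -> 'cV[R]_n) i b d : continuous y ->
  mu.-integrable `[b, d] (fun s => (affine_field A0 a0 A a (u s) (y s) i 0)%:E).
Proof.
move=> yc.
have cont (B : 'M[R]_n) (e : 'cV[R]_n) :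
    continuous (fun s => (B *m y s + e) i 0).
  move=> s; apply: (@cvg_coord _ _ _ _ _ _ (fun s => B *m y s + e)).
  by apply: cvgD; [exact/cvg_mulmx/yc | exact: cvg_cst].
have -> : (fun s => (affine_field A0 a0 A a (u s) (y s) i 0)%:E) =
    (fun s => ((A0 *m y s + a0) i 0)%:E +
      \sum_k (u s k 0 * (A k *m y s + a k) i 0)%:E)%E.
  apply/funext => s; rewrite /affine_field mxE EFinD summxE sumEFin.
  by congr (_ + _%:E)%E; apply: eq_bigr => k _; rewrite mxE.
apply: integrableD => //.
  apply: continuous_compact_integrable; first exact: segment_compact.
  exact: continuous_subspaceT.
by apply: integrable_sum => // k _; exact: integrable_admissibleM.
Qed.

Lemma affine_fieldB v x y : affine_field A0 a0 A a v x - affine_field A0 a0 A a v y =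
  A0 *m (x - y) + \sum_k v k 0 *: (A k *m (x - y)).
Proof.
rewrite /affine_field opprD addrACA; congr (_ + _).
  by rewrite opprD addrACA subrr addr0 -mulmxBr.
rewrite -sumrB; apply: eq_bigr => k _.
by rewrite -scalerBr opprD addrACA subrr addr0 -mulmxBr.
Qed.

(** The exceptional null set is that of the bound on the controls. It is independent of [x] and [y],
    so the estimate can be evaluated along two moving trajectories. *)
Lemma affine_field_ae_lipschitz : exists2 K : R, 0 < K &
  {ae mu, forall s, forall x y,
    `|affine_field A0 a0 A a (u s) x - affine_field A0 a0 A a (u s) y|
      <= K * `|x - y|}.
Proof.
have [C C0 uC] := admissible_ae_bounded.
pose K := n%:R * `|A0| + \sum_k C * (n%:R * `|A k|).
have K0 : 0 <= K.
  by rewrite addr_ge0 ?mulr_ge0// sumr_ge0// => k _; rewrite !mulr_ge0.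
(* [K] may vanish, whereas [zero_solution] divides by its constant. *)
exists (K + 1); first by rewrite ltr_wpDl.
apply: (filterS (Filter := ae_filter_ringOfSetsType mu)) uC => s uC x y.
rewrite affine_fieldB; apply: (@le_trans _ _ (K * `|x - y|)); last first.
  by rewrite ler_wpM2r// lerDl.
apply: le_trans (ler_normD _ _) _.
rewrite mulrDl lerD ?mulmx_norm_le// mulr_suml.
apply: le_trans (ler_norm_sum _ _ _) (ler_sum _ _) => k _.
by rewrite normrZ -mulrA ler_pM// mulmx_norm_le.
Qed.

Lemma affine_solution_unique x y1 y2 :
  is_solution (affine_field A0 a0 A a) u x y1 ->
  is_solution (affine_field A0 a0 A a) u x y2 -> y1 = y2.
Proof.
move=> sol1 sol2; have [c1 int1] := sol1; have [c2 int2] := sol2.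
have [K K0 uK] := affine_field_ae_lipschitz.
pose G (y : R -> 'cV[R]_n) s := affine_field A0 a0 A a (u s) (y s).
apply/funext => t; apply/eqP; rewrite -subr_eq0; apply/eqP; move: t.
apply: (@zero_solution R n (fun t => y1 t - y2 t) (fun s => G y1 s - G y2 s) K).
- by move=> t; apply: cvgB; [exact: c1 | exact: c2].
- exact: K0.
- move=> i b d.
  have -> : (fun s => ((G y1 s - G y2 s) i 0)%:E) =
      (fun s => (G y1 s i 0)%:E - (G y2 s i 0)%:E)%E.
    by apply/funext => s; rewrite !mxE EFinB.
  by apply: integrableB => //; exact: integrable_affine_field.
- by apply: (filterS (Filter := ae_filter_ringOfSetsType mu)) uK => s uK; exact: uK.
- move=> i b d bd.
  have coordB (v1 v2 : 'cV[R]_n) : (v1 - v2) i 0 = v1 i 0 - v2 i 0.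
    by rewrite !mxE.
  under eq_Rintegral do rewrite coordB.
  rewrite RintegralB//; [|exact: integrable_affine_field..].
  rewrite -!integral_from0B//; [|by move=> *; exact: integrable_affine_field..].
  have telescope (e p q r s : R) :
    e + p - (e + r) - (e + q - (e + s)) = p - q - (r - s) by ring.
  by rewrite !coordB !int1 !int2; exact: telescope.
- by rewrite (is_solution_at0 sol1) (is_solution_at0 sol2) subrr.
Qed.

End affine_solutions.

(** * The homeomorphism with the upper hemisphere *)

Section hemisphere.
Context {R : realType} {n : nat}.

(** Central projection from the origin onto the hyperplane where the last coordinate is 1. *)
Definition hemisphere_inv (s : 'cV[R]_(n + 1)) : 'cV[R]_n :=
  (s (rshift n ord0) 0)^-1 *: usubmx s.

Lemma enormZ (p : nat) (c : R) (y : 'cV[R]_p) : enorm (c *: y) = `|c| * enorm y.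
Proof.
rewrite /enorm -sqrtr_sqr -sqrtrM ?sqr_ge0// mulr_sumr.
by congr Num.sqrt; apply: eq_bigr => i _; rewrite mxE exprMn.
Qed.

Lemma radialZ (p : nat) (c : R) (y : 'cV[R]_p) : 0 < c -> radial (c *: y) = radial y.
Proof.
move=> c0; rewrite /radial enormZ gtr0_norm// invfM scalerA -mulrA mulrCA.
by rewrite mulVf ?mulr1 ?gt_eqF.
Qed.

Lemma enorm_col_mx1_gt0 (x : 'cV[R]_n) : 0 < enorm (col_mx x 1).
Proof.
rewrite sqrtr_gt0 big_split_ord/= big_ord1 col_mxEd mxE expr1n.
by rewrite ltr_wpDl// sumr_ge0// => i _; exact: sqr_ge0.
Qed.

Lemma enorm_radial (p : nat) (y : 'cV[R]_p) : 0 < enorm y -> enorm (radial y) = 1.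
Proof. by move=> y0; rewrite enormZ gtr0_norm ?invr_gt0// mulVf ?gt_eqF. Qed.

Lemma hemisphere_map_last (x : 'cV[R]_n) :
  hemisphere_map x (rshift n ord0) 0 = (enorm (col_mx x 1))^-1.
Proof. by rewrite mxE col_mxEd mxE mulr1. Qed.

Lemma hemisphere_mapP (x : 'cV[R]_n) : upper_hemisphere (hemisphere_map x).
Proof.
split; first exact/enorm_radial/enorm_col_mx1_gt0.
by rewrite hemisphere_map_last invr_gt0 enorm_col_mx1_gt0.
Qed.

Lemma hemisphere_mapK (x : 'cV[R]_n) : hemisphere_inv (hemisphere_map x) = x.
Proof.
rewrite /hemisphere_inv hemisphere_map_last invrK /hemisphere_map /radial.
rewrite linearZ/= col_mxKu scalerA divff ?scale1r//.
by rewrite gt_eqF// enorm_col_mx1_gt0.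
Qed.

(** A point and its central projection lie on one ray, which [radial] does not distinguish; this
    yields [hemisphere_invK]. *)
Lemma col_mx_hemisphere_inv (s : 'cV[R]_(n + 1)) : 0 < s (rshift n ord0) 0 ->
  col_mx (hemisphere_inv s) 1 = (s (rshift n ord0) 0)^-1 *: s.
Proof.
move=> s0; apply/colP => i; case: (split_ordP i) => k ->.
  by rewrite col_mxEu !mxE.
have -> : k = ord0 by rewrite (ord1 k); exact: val_inj.
by rewrite col_mxEd !mxE eqxx mulVf ?gt_eqF.
Qed.

Lemma hemisphere_invK (s : 'cV[R]_(n + 1)) : upper_hemisphere s ->
  hemisphere_map (hemisphere_inv s) = s.
Proof.
move=> [s1 s0]; rewrite /hemisphere_map col_mx_hemisphere_inv// radialZ ?invr_gt0//.
by rewrite /radial s1 invr1 scale1r.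
Qed.

Lemma cvg_enorm {T : Type} {F : set_system T} {FF : Filter F} (p : nat)
    (f : T -> 'cV[R]_p) (l : 'cV[R]_p) :
  f x @[x --> F] --> l -> enorm (f x) @[x --> F] --> enorm l.
Proof.
move=> fl; apply: (cvg_comp (fun x => \sum_i f x i 0 ^+ 2) Num.sqrt);
  last exact: sqrt_continuous.
apply: cvg_big => [|i _]; first exact: add_continuous.
under eq_fun do rewrite expr2.
by rewrite expr2; apply: cvgM; exact: cvg_coord.
Qed.

Lemma cvg_col_mx1 {T : Type} {F : set_system T} {FF : Filter F}
    (f : T -> 'cV[R]_n) (l : 'cV[R]_n) :
  f x @[x --> F] --> l -> col_mx (f x) (1 : 'cV[R]_1) @[x --> F] --> col_mx l 1.
Proof.
move=> fl; apply: cvg_mx => i j; case: (split_ordP i) => k ->.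
  rewrite col_mxEu; under eq_fun do rewrite col_mxEu.
  exact: cvg_coord.
rewrite col_mxEd; under eq_fun do rewrite col_mxEd.
exact: cvg_cst.
Qed.

Lemma continuous_hemisphere_map : continuous (@hemisphere_map R n).
Proof.
have col_cont : continuous (fun x : 'cV[R]_n => col_mx x (1 : 'cV[R]_1)).
  by move=> x; apply: (cvg_col_mx1 (F := nbhs x)); exact: cvg_id.
move=> x; apply: (@cvgZ _ _ _ (nbhs x) _ (fun x => (enorm (col_mx x 1))^-1)
  (fun x => col_mx x 1)); last exact: col_cont.
apply: (@cvgV _ _ (nbhs x) _ (fun x => enorm (col_mx x 1))).
  by rewrite gt_eqF// enorm_col_mx1_gt0.
by apply: (cvg_enorm (F := nbhs x)); exact: col_cont.
Qed.

Lemma continuous_hemisphere_inv :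
  {within @upper_hemisphere R n, continuous hemisphere_inv}.
Proof.
apply/subspace_continuousP => s [_ s0].
apply: cvg_within_filter; apply: (@cvgZ _ _ _ (nbhs s) _
  (fun s => (s (rshift n ord0) 0)^-1) usubmx).
  by apply: (@cvgV _ _ (nbhs s) _ (fun s => s (rshift n ord0) 0));
    [rewrite gt_eqF | exact: coord_continuous].
apply: (cvg_mx (F := nbhs s)) => i j; rewrite mxE; under eq_fun do rewrite mxE.
exact: coord_continuous.
Qed.

End hemisphere.

(** * Bilinear trajectories as scaled affine trajectories *)

Section induced_solutions.
Context {R : realType} {n m : nat}.
Notation mu := (@lebesgue_measure R).
Variables (A0 : 'M[R]_n) (a0 : 'cV[R]_n) (A : 'I_m -> 'M[R]_n)
  (a : 'I_m -> 'cV[R]_n) (Omega : set 'cV[R]_m) (u : R -> 'cV[R]_m).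
Hypothesis u_adm : admissible Omega u.

Lemma bilinear_field_embed v (c : R) y :
  bilinear_field A0 a0 A a v (c *: col_mx y 1) =
  c *: col_mx (affine_field A0 a0 A a v y) 0.
Proof.
have emb (B : 'M[R]_n) (b : 'cV[R]_n) :
    embed_mx B b *m col_mx y 1 = col_mx (B *m y + b) 0.
  by rewrite mul_block_col !mul0mx mulmx1 addr0.
rewrite /bilinear_field -scalemxAr emb.
under eq_bigr do rewrite -scalemxAr emb scalerA mulrC -scalerA.
rewrite -scaler_sumr -scalerDr /affine_field; congr (_ *: _).
have -> : \sum_i v i 0 *: col_mx (A i *m y + a i) (0 : 'cV_1) =
    col_mx (\sum_i v i 0 *: (A i *m y + a i)) 0.
  elim/big_rec2: _ => [|i y1 y2 _ ->]; first by rewrite col_mx0.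
  by rewrite scale_col_mx add_col_mx scaler0 addr0.
by rewrite add_col_mx addr0.
Qed.

(** The upper coordinates give [c] times the affine integral equation, where [c] cancels; the last
    one has zero right-hand side and stays equal to [c]. *)
Lemma is_solution_embed (c : R) x (y : R -> 'cV[R]_n) : c != 0 -> continuous y ->
  is_solution (bilinear_field A0 a0 A a) u (c *: col_mx x 1)
    (fun t => c *: col_mx (y t) 1) <->
  is_solution (affine_field A0 a0 A a) u x y.
Proof.
move=> c0 yc.
have top (v : 'cV[R]_n) (z : 'cV[R]_1) i :
  (c *: col_mx v z) (lshift 1 i) 0 = c * v i 0 by rewrite mxE col_mxEu.
have bot (v : 'cV[R]_n) (z : 'cV[R]_1) i :
  (c *: col_mx v z) (rshift n i) 0 = c * z i 0 by rewrite mxE col_mxEd.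
have int_top i t : integral_from0 (fun s => bilinear_field A0 a0 A a (u s)
    (c *: col_mx (y s) 1) (lshift 1 i) 0) t =
  c * integral_from0 (fun s => affine_field A0 a0 A a (u s) (y s) i 0) t.
  rewrite -integral_from0Z; last first.
    by move=> b d; exact: integrable_affine_field u_adm _ _ _ _ yc.
  by congr integral_from0; apply/funext => s; rewrite bilinear_field_embed top.
split=> -[_ sol]; split=> // t.
- move=> i; apply: (mulfI c0).
  by have := sol t (lshift 1 i); rewrite !top int_top mulrDr.
- by apply: cvgZl_tmp; apply: (cvg_col_mx1 (F := nbhs t)); exact: yc.
- move=> i; case: (split_ordP i) => k ->; first by rewrite !top int_top sol mulrDr.
  rewrite !bot integral_from0_eq0 ?addr0// => s.
  by rewrite bilinear_field_embed bot mxE mulr0.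
Qed.

(** The zero bottom row of [embed_mx] freezes the last coordinate at [c] for any solution, so
    dividing the upper block by [c] gives the curve [y]. *)
Lemma bilinear_solution_col (c : R) x Y : c != 0 ->
  is_solution (bilinear_field A0 a0 A a) u (c *: col_mx x 1) Y ->
  exists2 y : R -> 'cV[R]_n, continuous y & Y = (fun t => c *: col_mx (y t) 1).
Proof.
move=> c0 [Yc sol]; exists (fun t => c^-1 *: usubmx (Y t)).
  move=> t; apply: cvgZl_tmp; apply: (cvg_mx (F := nbhs t)) => i j.
  rewrite mxE; under eq_fun do rewrite mxE.
  by apply: (cvg_coord (F := nbhs t)); exact: Yc.
apply/funext => t; apply/colP => i; case: (split_ordP i) => k ->.
  by rewrite mxE col_mxEu !mxE mulrA divff// mul1r.
rewrite sol [LHS]addrC integral_from0_eq0 ?add0r => [|s].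
  by rewrite [LHS]mxE [RHS]mxE !col_mxEd.
rewrite /bilinear_field mxE -(vsubmxK (Y s)).
have emb (B : 'M[R]_n) b :
    (embed_mx B b *m col_mx (usubmx (Y s)) (dsubmx (Y s))) (rshift n k) 0 = 0.
  by rewrite mul_block_col col_mxEd !mul0mx addr0 mxE.
by rewrite emb add0r summxE big1// => l _; rewrite mxE emb mulr0.
Qed.

(* No existence of solutions is needed: if there are none, both flows are
   constant by the default value in [solution]. *)
Lemma sphere_flow_hemisphere_map t x :
  sphere_flow A0 a0 A a t (hemisphere_map x) u =
  hemisphere_map (affine_flow A0 a0 A a t x u).
Proof.
rewrite /sphere_flow /affine_flow /solution.
have c0 : 0 < (enorm (col_mx x 1))^-1 by rewrite invr_gt0 enorm_col_mx1_gt0.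
set c := (enorm (col_mx x 1))^-1 in c0.
rewrite -[in LHS]/(c *: col_mx x 1).
case: xgetP => [Y -> solY|noY].
  have [y yc Yy] := bilinear_solution_col (lt0r_neq0 c0) solY.
  move: solY; rewrite Yy => /(is_solution_embed x (lt0r_neq0 c0) yc) soly.
  rewrite radialZ// -[LHS]/(hemisphere_map (y t)); congr hemisphere_map.
  case: xgetP => [z -> solz|/(_ y)//].
  by rewrite (affine_solution_unique u_adm solz soly).
(* An affine solution would lift to a bilinear one, contradicting [noY]; only the default values are
   left, and they correspond under [radial]. *)
case: xgetP => [y _ soly|_].
  have [yc _] := soly.
  case: (noY (fun t => c *: col_mx (y t) 1)).
  exact: (is_solution_embed x (lt0r_neq0 c0) yc).2 soly.
by rewrite radialZ.
Qed.

End induced_solutions.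

Theorem corollary2 (R : realType) (n m : nat)
    (A0 : 'M[R]_n) (a0 : 'cV[R]_n) (A : 'I_m -> 'M[R]_n) (a : 'I_m -> 'cV[R]_n)
    (Omega : set 'cV[R]_m)
    (Omega_convex : convex_set Omega) (Omega_compact : compact Omega)
    (Omega_nbhs0 : nbhs (0 : 'cV[R]_m) Omega) (F : set 'cV[R]_(n + 1)) :
  strong_chain_control_set (@upper_hemisphere R n) (admissible Omega)
    (sphere_flow A0 a0 A a) F
  <->
  exists2 E : set 'cV[R]_n,
    strong_chain_control_set setT (admissible Omega) (affine_flow A0 a0 A a) E
    & F = (@hemisphere_map R n) @` E.
Proof.
have cj : chain_conjugacy (admissible Omega) setT (@upper_hemisphere R n)
    (affine_flow A0 a0 A a) (sphere_flow A0 a0 A a)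
    (@hemisphere_map R n) (@hemisphere_inv R n).
  (* The two conditions of membership in [M] are trivial here, since [M] is the whole space. *)
  split=> //.
  - exact/continuous_subspaceT/continuous_hemisphere_map.
  - exact: continuous_hemisphere_inv.
  - by move=> x _; exact: hemisphere_mapP.
  - by move=> x _; exact: hemisphere_mapK.
  - exact: hemisphere_invK.
  - by move=> t x u _ u_adm; exact: sphere_flow_hemisphere_map u_adm t x.
have cj' := chain_conjugacy_sym cj.
split=> [SF|[E SE ->]]; last exact: strong_chain_control_set_conjugacy cj SE.
exists (@hemisphere_inv R n @` F).
  exact: strong_chain_control_set_conjugacy cj' SF.
by case: SF => _ FM _ _; rewrite (conj_imageK cj' FM).
Qed.
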